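(* For every $n\ge1$, the Borel chromatic number of the Schreier graph of the shift action of $\mathbb{Z}^n$ on $F(2^{\mathbb{Z}^n})$ (with respect to the standard generators) equals $3$: $\chi_B(F(2^{\mathbb{Z}^n}))=3$.
   Context: $\mathbb{Z}^n$ acts on $2^{\mathbb{Z}^n}=\{0,1\}^{\mathbb{Z}^n}$ by the Bernoulli shift $(g\cdot x)(h)=x(g+h)$. The free part is $F(2^{\mathbb{Z}^n})=\{x\in2^{\mathbb{Z}^n}:\forall g\in\mathbb{Z}^n\setminus\{0\},\ g\cdot x\ne x\}$. The Schreier graph on $F(2^{\mathbb{Z}^n})$ has edges $(x,s\cdot x)$ for $s\in\{\pm e_1,\dots,\pm e_n\}$, the standard generators. The Borel chromatic number $\chi_B$ of a Borel graph is the least countable cardinal $\kappa$ for which there is a Borel map $c$ from the vertex set to $\kappa$ with $c(x)\ne c(y)$ whenever $x,y$ are adjacent. *)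

(* Defs.v *)
From HB Require Import structures.
From mathcomp Require Import all_boot all_order all_algebra.
From mathcomp Require Import all_classical all_reals topology measure.

Set Implicit Arguments.
Unset Strict Implicit.
Unset Printing Implicit Defensive.

Import Order.TTheory GRing.Theory Num.Theory.

Local Open Scope classical_set_scope.
Local Open Scope card_scope.
Local Open Scope ring_scope.

Definition borel_set (T : topologicalType) : set (set T) := <<s open >>.

Definition borel_map (T U : topologicalType) (f : T -> U) : Prop :=
  forall B : set U, borel_set B -> borel_set (f @^-1` B).

(* [Some k] is the finite cardinal k = {0, ..., k - 1}; [None] is aleph_0. *)
Definition countable_cardinal : Type := option nat.

Definition cardinal_set (kappa : countable_cardinal) : set nat :=
  if kappa is Some k then `I_k else [set: nat].

(* [nat] carries the discrete topology, hence so does every cardinal. *)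
Definition borel_colorable (V : topologicalType) (E : V -> V -> Prop)
    (kappa : countable_cardinal) : Prop :=
  exists c : V -> nat,
    [/\ borel_map c,
        forall x, cardinal_set kappa (c x) &
        forall x y, E x y -> c x <> c y].

(* A relation rather than a function: a graph with no Borel coloring by
   countably many colors is related to no cardinal. *)
Definition is_borel_chromatic_number (V : topologicalType)
    (E : V -> V -> Prop) (kappa : countable_cardinal) : Prop :=
  borel_colorable E kappa /\
  forall lambda : countable_cardinal,
    borel_colorable E lambda -> cardinal_set kappa #<= cardinal_set lambda.

Definition bernoulli_space (n : nat) : topologicalType :=
  prod_topology (fun _ : 'rV[int]_n => bool).

Definition shift (n : nat) (g : 'rV[int]_n) (x : bernoulli_space n) :
    bernoulli_space n :=
  fun h => x (g + h).

Definition free_part (n : nat) : set (bernoulli_space n) :=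
  [set x | forall g : 'rV[int]_n, g <> 0 -> shift g x <> x].
Arguments free_part : clear implicits.

Definition standard_generators (n : nat) : set 'rV[int]_n :=
  [set s | exists i : 'I_n, s = delta_mx 0 i \/ s = - delta_mx 0 i].

(* The canonical topology of [set_type] is the subspace topology. *)
Definition free_space (n : nat) : topologicalType := set_type (free_part n).

Definition schreier_graph (n : nat) (x y : free_space n) : Prop :=
  exists2 s : 'rV[int]_n,
    standard_generators s & set_val y = shift s (set_val x).
Arguments schreier_graph : clear implicits.

(* Main.v *)
(* Lower bound: a Borel 2-coloring would split the free part into a set with the
   Baire property and its image under a generator e.  Such a set is meager or
   comeager in some cylinder; a large odd multiple of e moves that cylinder to an
   independent one while exchanging the two colors, which contradicts the Baire
   category theorem.

   Upper bound: for each k there are finitely many Borel sets, their number not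
   depending on k, that are 16^(k+1)-separated and whose 16^k-neighborhoods cover
   the space.  By the pigeonhole principle some index recurs for infinitely many
   k, and the least such index is constant on orbits; selecting it gives, for
   each k, one 16^(k+1)-separated set of centers such that every point is within
   2 * 16^k of a center of some scale k.  Scale by scale, color the balls
   around the centers by parity relative to the center, leaving a rim of width 2
   around what has been reached so far.  When a later ball meets a component of
   the rim, the whole component and its neighbors are absorbed, so the component
   never grows again.  Points never placed in a rim get the colors 0 and 1 by
   parity relative to their center; rim points of even parity get the color 2,
   and those of odd parity avoid the color, 0 or 1, of their neighbors outside
   the rim, which all lie in one region since distinct regions are more than 2
   apart. *)

From HB Require Import structures.
Require Import Defs.
From mathcomp Require Import all_boot all_order all_algebra.
From mathcomp Require Import all_classical all_reals topology measure zify.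

Set Implicit Arguments.
Unset Strict Implicit.
Unset Printing Implicit Defensive.

Import Order.TTheory GRing.Theory Num.Theory.

Local Open Scope classical_set_scope.
Local Open Scope ring_scope.

(** * Cylinders, the shift action and Borel sets *)

Section Cylinders.
Variable n : nat.
Local Notation G := 'rV[int]_n.
Local Notation X := (bernoulli_space n).

(* The pair (s, t) prescribes the values on the finite set s, the value being
   1 exactly on t; so every condition is satisfied by some point. *)
Definition cylinder (p : seq G * seq G) : set X :=
  [set x | forall h, h \in p.1 -> x h = (h \in p.2)].

Definition cylinder_point (p : seq G * seq G) : X := fun h => h \in p.2.

Lemma cylinder_pointP p : cylinder p (cylinder_point p).
Proof. by []. Qed.

Definition restriction (s : seq G) (x : X) : seq G * seq G :=
  (s, [seq h <- s | x h]).

Lemma restrictionP s x y :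
  cylinder (restriction s x) y <-> forall h, h \in s -> y h = x h.
Proof.
by split=> H h hs; move: (H h hs); rewrite /= mem_filter hs andbT.
Qed.

Lemma mem_restriction s x : cylinder (restriction s x) x.
Proof. by apply/restrictionP. Qed.

Lemma restriction_sub s x p :
  cylinder p x -> {subset p.1 <= s} -> cylinder (restriction s x) `<=` cylinder p.
Proof.
move=> px ps y /restrictionP yx h hp; rewrite yx; last exact: ps.
exact: px.
Qed.

Lemma open_coordinate (h : G) (b : bool) : open [set x : X | x h = b].
Proof.
have cproj : continuous (fun x : X => x h : bool).
  exact: (@proj_continuous G (fun _ => bool) h).
exact: (proj1 (continuousP _) cproj [set b] (discrete_open _)).
Qed.

Lemma open_cylinder p : open (cylinder p).
Proof.
case: p => s t; elim: s => [|h s IH].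
  rewrite (_ : cylinder _ = setT); first exact: openT.
  by apply/seteqP; split.
rewrite (_ : cylinder _ =
    [set x : X | x h = (h \in t)] `&` cylinder (s, t)).
  by apply: openI => //; exact: open_coordinate.
apply/seteqP; split=> x /= => [H|[xh H] k].
  split; first by apply: H; rewrite mem_head.
  by move=> k ks; apply: H; rewrite /= inE ks orbT.
by rewrite inE => /orP[/eqP -> //|]; exact: H.
Qed.

(** The filter generated by the cylinders around [x] converges to [x]: in a product this is checked
    one coordinate at a time, where a one-element list suffices. *)
Lemma open_sub_cylinder (U : set X) x :
  open U -> U x -> exists s, cylinder (restriction s x) `<=` U.
Proof.
move=> oU Ux.
pose B := filter_from [set: seq G] (fun s => cylinder (restriction s x)).
have FB : Filter B.
  apply: filter_from_filter; first by exists [::].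
  move=> s t _ _; exists (s ++ t) => // y /restrictionP H.
  by split; apply/restrictionP => h hs; apply: H; rewrite mem_cat hs ?orbT.
have : B --> (x : X).
  apply/cvg_sup => h V [_ [[W oW <-] Wx] WV].
  exists [:: h] => // y /restrictionP H; apply: WV.
  by rewrite /= /proj H // mem_head.
move/(_ U) => []; first by apply: open_nbhs_nbhs; split.
by move=> s _ sU; exists s.
Qed.

End Cylinders.

Section Action.
Variable n : nat.
Local Notation G := 'rV[int]_n.
Local Notation X := (bernoulli_space n).
Local Notation F := (free_space n).

Lemma shiftD (g h : G) (x : X) : shift g (shift h x) = shift (g + h) x.
Proof. by apply/funext => k; rewrite /shift addrCA addrA. Qed.

Lemma shift0 (x : X) : shift 0 x = x.
Proof. by apply/funext => k; rewrite /shift add0r. Qed.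

Lemma shift_free (g : G) (x : X) : free_part n x -> free_part n (shift g x).
Proof.
move=> fx k k0 /(congr1 (shift (- g))).
by rewrite !shiftD addrAC addNr add0r shift0 => /(fx _ k0).
Qed.

Definition act (g : G) (x : F) : F :=
  exist _ (shift g (set_val x)) (mem_set (@shift_free g _ (set_mem (svalP x)))).

Lemma val_act g x : set_val (act g x) = shift g (set_val x).
Proof. by []. Qed.

Lemma free_space_inj (x y : F) : set_val x = set_val y -> x = y.
Proof. exact: val_inj. Qed.

Lemma actD g h x : act g (act h x) = act (g + h) x.
Proof. by apply: free_space_inj; rewrite !val_act shiftD. Qed.

Lemma act0 x : act 0 x = x.
Proof. by apply: free_space_inj; rewrite val_act shift0. Qed.

Lemma actNK g x : act (- g) (act g x) = x.
Proof. by rewrite actD addNr act0. Qed.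

(** Freeness makes the displacement between two points of an orbit unique, so that parity relative
    to a center is well defined. *)
Lemma act_inj g h x : act g x = act h x -> g = h.
Proof.
move=> /(congr1 (act (- h))); rewrite actNK actD => e.
apply/subr0_eq; rewrite addrC; apply: contrapT => ne.
exact: (set_mem (svalP x) _ ne (congr1 set_val e)).
Qed.

Lemma continuous_act g : continuous (act g).
Proof.
apply/continuousP => _ [U oU <-].
exists (shift g @^-1` U) => //.
rewrite openE => x Ux.
have [s sU] := open_sub_cylinder oU Ux.
apply: (@filterS _ _ _ (cylinder (restriction [seq g + h | h <- s] x))).
  move=> y /restrictionP H; apply: sU; apply/restrictionP => h hs.
  by apply: H; apply/mapP; exists h.
apply: open_nbhs_nbhs; split; first exact: open_cylinder.
exact: mem_restriction.
Qed.

End Action.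

Section BorelSets.
Variable T : topologicalType.
Implicit Types A B : set T.

Lemma borel_open A : open A -> borel_set A.
Proof. exact: sub_sigma_algebra. Qed.

Lemma borel_const (P : Prop) : borel_set [set _ : T | P].
Proof.
have [p|p] := pselect P.
  rewrite (_ : [set _ | _] = setT); first by apply: borel_open; exact: openT.
  by apply/seteqP; split.
rewrite (_ : [set _ | _] = set0); first by apply: borel_open; exact: open0.
by apply/seteqP; split.
Qed.

Lemma borel_setC A : borel_set A -> borel_set (~` A).
Proof. by move=> bA; rewrite -setTD; apply: sigma_algebraCD. Qed.

Lemma borel_exists (I : countType) (A : I -> set T) :
  (forall i, borel_set (A i)) -> borel_set [set x | exists i, A i x].
Proof.
move=> bA; rewrite (_ : [set x | _] =
    \bigcup_k (if unpickle k is Some i then A i else set0)).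
  apply: sigma_algebra_bigcup => k; case: unpickle => [i|]; first exact: bA.
  exact: sigma_algebra0.
apply/seteqP; split=> x => [[i Ax]|[k _]].
  by exists (pickle i) => //; rewrite pickleK.
by case: unpickle => // i Ax; exists i.
Qed.

Lemma borel_forall (I : countType) (A : I -> set T) :
  (forall i, borel_set (A i)) -> borel_set [set x | forall i, A i x].
Proof.
move=> bA; rewrite (_ : [set x | _] = ~` [set x | exists i, (~` A i) x]).
  by apply: borel_setC; apply: borel_exists => i; apply: borel_setC.
by apply/seteqP; split=> x /= => [H [i]|H i]; [exact|apply: contrapT => N; apply: H; exists i].
Qed.

Lemma borel_setU A B : borel_set A -> borel_set B -> borel_set (A `|` B).
Proof.
move=> bA bB; rewrite (_ : _ `|` _ = [set x | exists b : bool, (if b then A else B) x]).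
  by apply: borel_exists; case.
apply/seteqP; split=> x; first by case; [exists true|exists false].
by case=> -[]; [left|right].
Qed.

Lemma borel_setI A B : borel_set A -> borel_set B -> borel_set (A `&` B).
Proof.
move=> bA bB; rewrite -(setCK (A `&` B)) setCI.
by apply: borel_setC; apply: borel_setU; apply: borel_setC.
Qed.

Lemma borel_mapP (f : T -> nat) :
  (forall k, borel_set [set x | f x = k]) -> borel_map f.
Proof.
move=> bf B _; rewrite (_ : f @^-1` B = [set x | exists k, f x = k /\ B k]).
  by apply: borel_exists => k; apply: (borel_setI (bf k)); exact: borel_const.
by apply/seteqP; split=> x => [Bx|[k [<-]]//]; exists (f x).
Qed.

End BorelSets.

Lemma borel_preimage (T U : topologicalType) (f : U -> T) (A : set T) :
  continuous f -> borel_set A -> borel_set (f @^-1` A).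
Proof.
move=> cf; move: A.
apply: (@smallest_sub _ (sigma_algebra setT) open
          [set A | borel_set (f @^-1` A)]) => [|A oA]; last first.
  by apply: borel_open; exact: (proj1 (continuousP f) cf).
split.
- by rewrite /= preimage_set0; exact: sigma_algebra0.
- by move=> A bA; rewrite /= setTD preimage_setC; exact: borel_setC.
- by move=> A bA; rewrite /= preimage_bigcup; exact: sigma_algebra_bigcup.
Qed.

(** * Baire category and the lower bound *)

Section Category.
Variable n : nat.
Local Notation G := 'rV[int]_n.
Local Notation X := (bernoulli_space n).
Local Notation F := (free_space n).
Implicit Types (p q r : seq G * seq G) (A B : set X) (g : G).

(** Category is taken in the whole space [X], where cylinders are nonempty and countable in number;
    the non-free points turn out to be meager. *)
Definition nowhere_dense A := forall p,
  exists2 q, cylinder q `<=` cylinder p & cylinder q `<=` ~` A.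

Definition meager A := exists2 B : nat -> set X,
  forall i, nowhere_dense (B i) & A `<=` \bigcup_i B i.

Lemma nowhere_dense0 : nowhere_dense set0.
Proof. by move=> p; exists p => // x _ []. Qed.

Lemma meager_sub A B : A `<=` B -> meager B -> meager A.
Proof. by move=> AB [C nC BC]; exists C => //; apply: subset_trans BC. Qed.

Lemma nowhere_dense_meager A : nowhere_dense A -> meager A.
Proof. by move=> nA; exists (fun=> A) => // x Ax; exists 0%N. Qed.

Lemma meager0 : meager set0.
Proof. exact/nowhere_dense_meager/nowhere_dense0. Qed.

Lemma meager_exists (I : countType) (A : I -> set X) :
  (forall i, meager (A i)) -> meager [set x | exists i, A i x].
Proof.
move=> mA.
have /choice[B mB] : forall i, exists B : nat -> set X,
    (forall j, nowhere_dense (B j)) /\ A i `<=` \bigcup_j B j.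
  by move=> i; have [B] := mA i; exists B.
exists (fun k => if unpickle k is Some ij then B ij.1 ij.2 else set0).
  by move=> k; case: unpickle => [[i j]|]; [exact: (mB i).1|exact: nowhere_dense0].
move=> x [i /(mB i).2[j _ Bx]].
by exists (pickle (i, j)) => //; rewrite pickleK.
Qed.

Lemma meagerU A B : meager A -> meager B -> meager (A `|` B).
Proof.
move=> mA mB; apply: (@meager_sub _ [set x | exists b : bool, (if b then A else B) x]).
  by move=> x; case; [exists true|exists false].
by apply: meager_exists; case.
Qed.

Theorem baire_category p : ~ meager (cylinder p).
Proof.
move=> [B nB pB].
have /choice[next nextP] : forall iq : nat * (seq G * seq G), exists r,
    cylinder r `<=` cylinder iq.2 /\ cylinder r `<=` ~` B iq.1.
  by move=> [i q]; have [r] := nB i q; exists r.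
pose s := fix s i := if i is j.+1 then next (j, s j) else p.
have s_le i j : (i <= j)%N -> cylinder (s j) `<=` cylinder (s i).
  elim: j => [|j IH]; first by rewrite leqn0 => /eqP->.
  rewrite leq_eqVlt => /orP[/eqP->//|/IH ij].
  by apply: subset_trans ij; have [] := nextP (j, s j).
(* The limit of the nested cylinders [s i]. Two stages that fix the same [h] agree on it, because
   the later of the two contains a point, which satisfies both. *)
pose x : X := fun h => `[< exists2 i, h \in (s i).1 & h \in (s i).2 >].
have sx i : cylinder (s i) x.
  move=> h hi; apply/asboolP/idP => [[j hj hj2]|hi2]; last by exists i.
  pose y := cylinder_point (s (maxn i j)).
  have yi := s_le _ _ (leq_maxl i j) y (@cylinder_pointP _ _) h hi.
  have yj := s_le _ _ (leq_maxr i j) y (@cylinder_pointP _ _) h hj.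
  by rewrite -yi yj.
have [i _ Bix] := pB x (sx 0%N).
by have [_ /(_ x (sx i.+1))] := nextP (i, s i).
Qed.

Definition translate g p := (map (+%R g) p.1, map (+%R g) p.2).

Lemma translateP g p x : cylinder (translate g p) x <-> cylinder p (shift g x).
Proof.
split=> H h; last first.
  by case/mapP=> k kp ->; rewrite -[x _]/(shift g x k) H// mem_map //; exact: addrI.
move=> hp; rewrite /shift H /=; last by apply/mapP; exists h.
by rewrite mem_map //; exact: addrI.
Qed.

Lemma meager_shift g A : meager A -> meager (shift g @^-1` A).
Proof.
move=> [B nB AB]; exists (fun i => shift g @^-1` B i) => [i p|x /AB[i _ Bx]]; last first.
  by exists i.
have [q qp qB] := nB i (translate (- g) p).
exists (translate g q) => x /translateP qx; last exact: qB.
by move/translateP: (qp _ qx); rewrite shiftD addNr shift0.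
Qed.

(** A local form of being open modulo a meager set. It is symmetric in [S] and its complement in the
    free part, so closure under complements is immediate. *)
Definition baire_property (S : set F) := forall p,
  exists2 q, cylinder q `<=` cylinder p &
    meager (cylinder q `&` set_val @` S) \/
    meager (cylinder q `&` set_val @` (~` S)).

Lemma baire_propertyC S : baire_property S -> baire_property (~` S).
Proof.
move=> bS p; have [q qp H] := bS p; exists q => //.
by rewrite setCK; case: H; [right|left].
Qed.

Lemma baire_property_open S : open S -> baire_property S.
Proof.
move=> [U oU <-] p.
have [[x px Ux]|N] := pselect (exists2 x, cylinder p x & U x).
  have [s sU] := open_sub_cylinder oU Ux.
  exists (restriction (s ++ p.1) x).
    by apply: restriction_sub => // h; rewrite mem_cat orbC => ->.
  right; apply: meager_sub meager0 => y [/restrictionP yx [z nUz zy]].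
  apply: nUz; rewrite /= zy; apply: sU.
  by apply/restrictionP => h hs; rewrite yx // mem_cat hs.
exists p => //; left; apply: meager_sub meager0 => y [py [z Uz zy]].
by apply: N; exists y => //; rewrite -zy.
Qed.

Lemma baire_property_bigcup (S : nat -> set F) :
  (forall i, baire_property (S i)) -> baire_property (\bigcup_i S i).
Proof.
move=> bS p.
(* If the complement of some [S i] is meager in a cylinder inside [p], so is that of the union.
   Otherwise every [S i] is meager in densely many cylinders inside [p]. *)
have [[i [q qp mq]]|N] := pselect (exists i, exists2 q, cylinder q `<=` cylinder p &
    meager (cylinder q `&` set_val @` (~` S i))).
  exists q => //; right; apply: meager_sub mq => x [qx [y nSy yx]]; split=> //.
  by exists y => // Sy; apply: nSy; exists i.
exists p => //; left.
(* [M i] is a countable union of meager pieces of [S i], and [D i], what the cylinders of these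
   pieces leave of [p], is nowhere dense. *)
pose M i := [set x | exists q, (meager (cylinder q `&` set_val @` S i) /\ cylinder q x)
                              /\ (set_val @` S i) x].
pose D i := [set x | cylinder p x /\
  ~ exists2 q, meager (cylinder q `&` set_val @` S i) & cylinder q x].
apply: (@meager_sub _ [set x | exists i, (D i `|` M i) x]) => [x [px [y [i _ Sy] yx]]|].
  exists i; have [[q mq qx]|nq] := pselect
      (exists2 q, meager (cylinder q `&` set_val @` S i) & cylinder q x); last by left.
  by right; exists q; split=> //; exists y.
apply: meager_exists => i; apply: meagerU; last first.
  apply: meager_exists => q.
  have [mq|nmq] := pselect (meager (cylinder q `&` set_val @` S i)).
    by apply: meager_sub mq => x [[_ qx] Sx].
  by apply: meager_sub meager0 => x [[]].
apply: nowhere_dense_meager => r.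
have [[x rx px]|disj] := pselect (exists2 x, cylinder r x & cylinder p x); last first.
  by exists r => // x rx [px _]; apply: disj; exists x.
pose t := restriction (r.1 ++ p.1) x.
have tr : cylinder t `<=` cylinder r.
  by apply: restriction_sub => // h; rewrite mem_cat => ->.
have tp : cylinder t `<=` cylinder p.
  by apply: restriction_sub => // h; rewrite mem_cat orbC => ->.
have [q qt mq] := bS i t; exists q; first exact: subset_trans tr.
have {}mq : meager (cylinder q `&` set_val @` S i).
  case: mq => // mq; exfalso; apply: N; exists i, q => //.
  exact: subset_trans tp.
by move=> y qy [_]; apply; exists q.
Qed.

Lemma borel_baire_property S : borel_set S -> baire_property S.
Proof.
move: S; apply: (@smallest_sub _ (sigma_algebra setT) open baire_property).
  split.
  - by apply: baire_property_open; exact: open0.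
  - by move=> S; rewrite setTD; exact: baire_propertyC.
  - exact: baire_property_bigcup.
exact: baire_property_open.
Qed.

(** * Sets that alternate along a generator *)

Variable i0 : 'I_n.
Let e : G := delta_mx 0 i0.

Lemma fresh_multiple (s : seq G) :
  exists m0, forall m, (m0 <= m)%N -> e *+ m \notin s.
Proof.
elim: s => [|a s [m0 H]]; first by exists 0%N.
have [[k ka]|N] := pselect (exists k, e *+ k = a); last first.
  exists m0 => m /H ms; rewrite inE negb_or ms andbT.
  by apply/eqP => ma; apply: N; exists m.
exists (maxn m0 k.+1) => m; rewrite geq_max => /andP[/H ms km].
rewrite inE negb_or ms andbT; apply/eqP => ma.
have entry j : (e *+ j) ord0 i0 = (j%:R : int).
  elim: j => [|j IH]; first by rewrite mulr0n mxE.
  by rewrite mulrS [RHS]mulrS mxE IH mxE !eqxx.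
have /eqP : (m%:R : int) = k%:R by rewrite -!entry ma ka.
by rewrite eqr_nat => /eqP mk; rewrite mk ltnn in km.
Qed.

Lemma meager_not_free : meager (~` free_part n).
Proof.
apply: (@meager_sub _ [set x | exists g, g <> 0 /\ shift g x = x]).
  move=> x nfx; apply: contrapT => N; apply: nfx => g g0 gx.
  by apply: N; exists g.
apply: meager_exists => g; apply: nowhere_dense_meager => p.
have [->|/eqP g0] := eqVneq g 0; first by exists p => // x _ [].
(* With [h] and [g + h] both outside [p.1], the values 1 at [h] and 0 at [g + h] are compatible with
   [p] and prevent [g] from fixing the point. *)
have [m /(_ m (leqnn m))] := fresh_multiple (p.1 ++ map (fun k => k - g) p.1).
set h := e *+ m; rewrite mem_cat negb_or => /andP[hp hgp].
have {}hgp : g + h \notin p.1.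
  by apply: contra hgp => ghp; apply/mapP; exists (g + h) => //; rewrite addrC addKr.
pose y : X := fun k => if k == h then true else if k == g + h then false else k \in p.2.
have py : cylinder p y.
  move=> k kp; rewrite /y; case: eqP => [kh|_]; first by rewrite -kh kp in hp.
  by case: eqP => [kh|//]; rewrite -kh kp in hgp.
exists (restriction [:: h, g + h & p.1] y).
  by apply: restriction_sub => // k kp; rewrite !inE kp !orbT.
move=> x /restrictionP xy [_ /(congr1 (fun x : X => x h))].
rewrite /shift !xy ?inE ?eqxx ?orbT // /y !eqxx.
by case: eqP => // gh; have := addIr h (etrans gh (esym (add0r h))).
Qed.

(* A translate by a large odd multiple of e is independent of the finitely many
   coordinates fixed by q, yet it exchanges S and its complement. *)
Lemma alternating_nonmeager (S : set F) q :
  (forall x, S (act e x) <-> ~ S x) -> ~ meager (cylinder q `&` set_val @` S).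
Proof.
move=> altS mS.
(* Avoiding these differences makes [q.1] disjoint from its translate by [g]; taking [m] odd makes
   [g] exchange [S] and its complement. *)
have [m0 fresh] := fresh_multiple [seq k - k' | k <- q.1, k' <- q.1].
pose m := (m0.*2.+1)%N.
have /fresh qm : (m0 <= m)%N by rewrite /m -addnn -addnS leq_addr.
set g := e *+ m in qm.
have toggle k x : S (act (e *+ k) x) <-> (if odd k then ~ S x else S x).
  elim: k => [|k IH]; first by rewrite mulr0n act0.
  rewrite mulrS -actD altS IH /=; case: (odd k) => /=; last by [].
  by split=> [/contrapT|Sx nSx].
have altg x : S (act g x) <-> ~ S x by rewrite toggle /m /= odd_double.
pose y : X := fun k => if k \in q.1 then k \in q.2 else k - g \in q.2.
have qy : cylinder q y by move=> h hq; rewrite /y hq.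
have qgy : cylinder q (shift g y).
  move=> h hq; rewrite /shift /y ifN; first by rewrite addrC addKr.
  apply: contra qm => ghq; apply/allpairsP; exists (g + h, h); split=> //=.
  by rewrite addrK.
apply: (@baire_category (restriction (q.1 ++ map (+%R g) q.1) y)).
(* Near [y] both [z] and [shift g z] lie in [cylinder q], and for free [z] one of them is in [S]; so
   meager sets would cover a whole cylinder. *)
apply: (@meager_sub _ ((cylinder q `&` set_val @` S `|`
    shift g @^-1` (cylinder q `&` set_val @` S)) `|` ~` free_part n)); last first.
  apply: meagerU; last exact: meager_not_free.
  by apply: meagerU => //; exact: meager_shift.
move=> z /restrictionP zy.
have qz : cylinder q z by move=> h hq; rewrite zy ?mem_cat ?hq // qy.
have qgz : cylinder q (shift g z).
  move=> h hq; rewrite /shift zy; first exact: qgy.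
  by rewrite mem_cat; apply/orP; right; apply/mapP; exists h.
have [fz|nfz] := pselect (free_part n z); last by right.
left; pose x : F := exist _ z (mem_set fz).
have [Sx|/altg Sx] := pselect (S x); [left|right]; split=> //.
  by exists x.
by exists (act g x).
Qed.

Lemma alternating_not_borel (S : set F) :
  (forall x, S (act e x) <-> ~ S x) -> ~ borel_set S.
Proof.
move=> altS /borel_baire_property/(_ ([::], [::]))[q _ []].
  exact: alternating_nonmeager.
apply: alternating_nonmeager => x.
rewrite /setC /=; have := altS x.
by split=> H1 H2; tauto.
Qed.

End Category.

(** * Borel maximal separated sets *)

Section Norm.
Variable n : nat.
Local Notation G := 'rV[int]_n.
Implicit Types g h : G.

Definition nrm g : nat := (\max_(i < n) `|g ord0 i|)%N.

Lemma nrm_leP g r : reflect (forall i, `|g ord0 i| <= r)%N (nrm g <= r)%N.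
Proof.
by apply: (iffP (bigmax_leqP _ _ _)) => H i; [exact: H|move=> _; exact: H].
Qed.

Lemma nrm_coord g i : (`|g ord0 i| <= nrm g)%N.
Proof. exact/nrm_leP. Qed.

Lemma nrm0 : nrm 0 = 0%N.
Proof. by apply/eqP; rewrite -leqn0; apply/nrm_leP => i; rewrite mxE. Qed.

Lemma nrmN g : nrm (- g) = nrm g.
Proof. by apply: eq_bigr => i _; rewrite mxE abszN. Qed.

Lemma nrmD g h : (nrm (g + h) <= nrm g + nrm h)%N.
Proof.
apply/nrm_leP => i; rewrite mxE; have := nrm_coord g i; have := nrm_coord h i.
move: (nrm g) (nrm h) (g _ _) (h _ _) => a b u v.
lia.
Qed.

(** The 2-coloring of the Cayley graph, as a homomorphism to Z/2. Working in ['F_2] reduces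
    additivity to a check of four cases. *)
Definition parity g : bool := ((\sum_i g ord0 i)%:~R : 'F_2) != 0.

Lemma parityD g h : parity (g + h) = parity g (+) parity h.
Proof.
rewrite /parity; under eq_bigr do rewrite mxE.
rewrite big_split intrD.
by move: (_%:~R) (_%:~R) => [[|[|//]] ?] [[|[|//]] ?].
Qed.

Lemma parityN g : parity (- g) = parity g.
Proof.
rewrite /parity; under eq_bigr do rewrite mxE.
by rewrite sumrN mulrNz oppr_eq0.
Qed.

Lemma nrm_generator g : standard_generators g -> (nrm g <= 1)%N.
Proof.
have nd i : (nrm (delta_mx 0%R i : G) <= 1)%N.
  by apply/nrm_leP => j; rewrite mxE; case: (_ && _).
by case=> i [] ->; rewrite ?nrmN.
Qed.

Lemma parity_generator g : standard_generators g -> parity g.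
Proof.
have pd i : parity (delta_mx 0 i : G).
  rewrite /parity (bigD1 i) //= big1 ?addr0 => [|j ji]; first by rewrite mxE !eqxx.
  by rewrite mxE (negbTE ji) andbF.
by case=> i [] ->; rewrite ?parityN.
Qed.

Lemma generatorN g : standard_generators g -> standard_generators (- g).
Proof. by case=> i [] ->; exists i; [right|left; rewrite opprK]. Qed.

Definition ball (r : nat) : seq G :=
  [seq \row_i ((f i : nat)%:Z - r%:Z) | f : {ffun 'I_n -> 'I_(r.*2.+1)}].

Lemma mem_ball r g : (nrm g <= r)%N -> g \in ball r.
Proof.
move=> /nrm_leP gr; apply/mapP; exists [ffun i => inord `|g ord0 i + r%:Z|].
  by rewrite mem_enum.
apply/rowP => i; rewrite mxE ffunE inordK; have := gr i; move: (g _ _) => u; lia.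
Qed.

End Norm.

Section Neighborhoods.
Variable n : nat.
Local Notation G := 'rV[int]_n.
Local Notation F := (free_space n).
Implicit Types (g h : G) (x y z : F) (A B : set F).

Definition close (r : nat) x y := exists2 g, (nrm g <= r)%N & y = act g x.

Lemma close_refl r x : close r x x.
Proof. by exists 0; rewrite ?nrm0 ?act0. Qed.

Lemma close_sym r x y : close r x y -> close r y x.
Proof. by case=> g gr ->; exists (- g); rewrite ?nrmN ?actNK. Qed.

Lemma close_trans r s x y z : close r x y -> close s y z -> close (r + s) x z.
Proof.
case=> g gr -> [h hs ->]; exists (h + g); last by rewrite actD.
by rewrite (leq_trans (nrmD _ _)) // addnC leq_add.
Qed.

Lemma close_le r s x y : (r <= s)%N -> close r x y -> close s x y.
Proof. by move=> rs [g gr ->]; exists g => //; exact: leq_trans rs. Qed.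

Definition nbh (r : nat) A : set F := [set x | exists2 y, close r x y & A y].

Lemma nbh_le r s A : (r <= s)%N -> nbh r A `<=` nbh s A.
Proof. by move=> rs x [y xy Ay]; exists y => //; exact: close_le xy. Qed.

Lemma nbh_sub r A : A `<=` nbh r A.
Proof. by move=> x Ax; exists x => //; exact: close_refl. Qed.

Lemma nbh_close r s A x y : close r x y -> nbh s A y -> nbh (r + s) A x.
Proof. by move=> xy [z yz Az]; exists z => //; exact: close_trans yz. Qed.

Lemma borel_act g A : borel_set A -> borel_set (act g @^-1` A).
Proof. by apply: borel_preimage; exact: continuous_act. Qed.

Lemma borel_nbh r A : borel_set A -> borel_set (nbh r A).
Proof.
move=> bA; rewrite (_ : nbh r A =
    [set x | exists g, ([set _ : F | (nrm g <= r)%N] `&` act g @^-1` A) x]).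
  apply: borel_exists => g; apply: borel_setI; first exact: borel_const.
  exact: borel_act.
apply/seteqP; split=> x; first by case=> _ [g gr ->] Ax; exists g.
by case=> g [gr Ax]; exists (act g x) => //; exists g.
Qed.

Definition separated (r : nat) A :=
  forall x y, A x -> A y -> close r x y -> x = y.

(** The separation condition does not involve [x], so this is either the whole trace of the cylinder
    or empty, hence Borel. *)
Definition separated_cylinder r (p : seq G * seq G) : set F :=
  [set x | cylinder p (set_val x) /\ separated r (set_val @^-1` cylinder p)].

Lemma separated_cylinder_separated r p : separated r (separated_cylinder r p).
Proof. by move=> x y [px sp] [py _]; exact: sp. Qed.

Lemma borel_separated_cylinder r p : borel_set (separated_cylinder r p).
Proof.
apply: (@borel_setI _ (set_val @^-1` cylinder p) [set _ | _]); last exact: borel_const.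
by apply: borel_open; exists (cylinder p) => //; exact: open_cylinder.
Qed.

(** By freeness each nonzero [g] of norm at most [r] changes [x] at some coordinate [w g]. Fixing
    the values of [x] at [w g] and [g + w g] keeps [y] and [act g y] from both lying in the
    cylinder. *)
Lemma separated_cylinder_cover r x : exists p, separated_cylinder r p x.
Proof.
have /choice[w wP] : forall g, exists h,
    g <> 0 -> set_val x (g + h) <> set_val x h.
  move=> g; have [->|g0] := pselect (g = 0); first by exists 0.
  apply: contrapT => N; apply: (set_mem (svalP x) g g0).
  apply/funext => h; apply: contrapT => ne; apply: N; exists h => _; exact: ne.
pose s := map w (ball n r) ++ map (fun g => g + w g) (ball n r).
exists (restriction s (set_val x)); split; first exact: mem_restriction.
move=> y z /restrictionP yx /restrictionP zx [g gr zy].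
have [g0|/(wP g)[]] := pselect (g = 0); first by rewrite zy g0 act0.
have gb := mem_ball gr.
rewrite -yx; last by rewrite mem_cat; apply/orP; right; apply/mapP; exists g.
rewrite -zx ?zy //; last by rewrite mem_cat; apply/orP; left; apply/mapP; exists g.
Qed.

(** The cylinders are treated one at a time along their enumeration; the points of one cylinder can
    be added simultaneously because they do not conflict with each other. *)
Definition greedy r A := fix acc k : set F :=
  if k is j.+1 then
    acc j `|` (A `&` (if unpickle j is Some p then separated_cylinder r p else set0)
                 `&` ~` nbh r (acc j))
  else set0.

Definition maximal_separated r A := \bigcup_k greedy r A k.

Lemma greedy_le r A i j : (i <= j)%N -> greedy r A i `<=` greedy r A j.
Proof.
elim: j => [|j IH]; first by rewrite leqn0 => /eqP->.
rewrite leq_eqVlt => /orP[/eqP->//|/IH ij].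
by apply: subset_trans ij _; left.
Qed.

Lemma greedy_separated r A k : separated r (greedy r A k).
Proof.
elim: k => [x y []|k IH x y [Ax|[[_ xp] nx]] [Ay|[[_ yp] ny]] xy].
- exact: IH.
- by exfalso; apply: ny; exists x => //; exact: close_sym.
- by exfalso; apply: nx; exists y.
- case: unpickle xp yp => // p xp yp; exact: (@separated_cylinder_separated r p).
Qed.

Lemma maximal_separated_separated r A : separated r (maximal_separated r A).
Proof.
move=> x y [i _ Ax] [j _ Ay]; apply: (@greedy_separated r A (maxn i j)).
  exact: (greedy_le (leq_maxl i j)) Ax.
exact: (greedy_le (leq_maxr i j)) Ay.
Qed.

Lemma maximal_separated_sub r A : maximal_separated r A `<=` A.
Proof. by move=> x [k _]; elim: k => //= k IH [/IH //|[[]]]. Qed.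

Lemma maximal_separated_maximal r A : A `<=` nbh r (maximal_separated r A).
Proof.
move=> x Ax; have [p px] := separated_cylinder_cover r x.
have [[y xy Ay]|nx] := pselect (nbh r (greedy r A (pickle p)) x).
  by exists y => //; exists (pickle p).
by apply: nbh_sub; exists (pickle p).+1 => //; right; rewrite pickleK.
Qed.

Lemma borel_maximal_separated r A :
  borel_set A -> borel_set (maximal_separated r A).
Proof.
move=> bA; apply: sigma_algebra_bigcup; elim=> [|k IH]; first exact: sigma_algebra0.
apply: borel_setU => //; apply: borel_setI; last first.
  by apply: borel_setC; exact: borel_nbh.
apply: borel_setI => //; case: unpickle => [p|]; last exact: sigma_algebra0.
exact: borel_separated_cylinder.
Qed.

End Neighborhoods.

(** * Centers of all scales *)

Section Centers.
Variable n : nat.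
Local Notation G := 'rV[int]_n.
Local Notation F := (free_space n).
Implicit Types (g h : G) (x y z : F) (l i j k t : nat).

(** A single [16 * l]-separated set cannot be expected to cover with radius [l], so the selection is
    repeated on what is left. *)
Definition uncovered l := fix unc i : set F :=
  if i is j.+1 then
    unc j `&` ~` nbh l (maximal_separated (16 * l) (unc j))
  else setT.

Definition layer l i := maximal_separated (16 * l) (uncovered l i).

Lemma uncovered_layer l i j x :
  (i < j)%N -> uncovered l j x -> ~ nbh l (layer l i) x.
Proof.
elim: j => // j IH; rewrite ltnS leq_eqVlt => /orP[/eqP->|ij] [uj nj] //.
exact: IH.
Qed.

Lemma layer_separated l i : separated (16 * l) (layer l i).
Proof. exact: maximal_separated_separated. Qed.

Lemma borel_layer l i : borel_set (layer l i).
Proof.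
apply: borel_maximal_separated; elim: i => [|i IH].
  by apply: borel_open; exact: openT.
apply: borel_setI => //; apply: borel_setC; apply: borel_nbh.
exact: borel_maximal_separated.
Qed.

(* A point missed by all layers has a center of each layer within 16 l; those
   centers are pairwise more than l apart, which bounds their number independently of l. *)
Lemma layer_cover l x : exists2 i, (i <= 33 ^ n)%N & nbh l (layer l i) x.
Proof.
apply: contrapT => N.
have unc i : (i <= 33 ^ n)%N -> uncovered l i x.
  elim: i => // i IH iK; split; first exact/IH/ltnW.
  by move=> xi; apply: N; exists i => //; exact: ltnW.
have /choice[c cP] : forall i : 'I_(33 ^ n).+1, exists g,
    (nrm g <= 16 * l)%N /\ layer l i (act g x).
  move=> i; have [_ [g gl ->] gi] :=
    maximal_separated_maximal (16 * l) (unc i (ltn_ord i)).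
  by exists g.
(* Shifted coordinates lie between 0 and [32 * l], hence in one of 33 intervals of length [l + 1].
   Centers sharing a cell are within [l], and there are only [33 ^ n] cells for [33 ^ n + 1]
   centers. *)
pose cell (i : 'I_(33 ^ n).+1) : {ffun 'I_n -> 'I_33} :=
  [ffun k => inord (`|(c i ord0 k + (16 * l)%:Z)%R| %/ l.+1)%N].
have far (i j : 'I_(33 ^ n).+1) : (i < j)%N -> cell i <> cell j.
  move=> ij /ffunP cij.
  have [[ci li] [cj lj]] := (cP i, cP j).
  apply: (@uncovered_layer l i j (act (c j) x)) => //.
    exact: maximal_separated_sub lj.
  exists (act (c i) x) => //; exists (c i - c j); last by rewrite actD subrK.
  apply/nrm_leP => k; rewrite !mxE.
  have := congr1 val (cij k); rewrite !ffunE.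
  have {ci}ci := leq_trans (nrm_coord (c i) k) ci.
  have {cj}cj := leq_trans (nrm_coord (c j) k) cj.
  move: (c i _ _) (c j _ _) ci cj => u v ul vl.
  have small w : (`|w| <= 16 * l)%N -> (`|(w + (16 * l)%:Z)%R| %/ l.+1 < 33)%N.
    by move=> wl; rewrite ltn_divLR //; lia.
  rewrite /= !inordK; try exact: small.
  move: (divn_eq `|(u + (16 * l)%:Z)%R| l.+1) (divn_eq `|(v + (16 * l)%:Z)%R| l.+1).
  move: (ltn_pmod `|(u + (16 * l)%:Z)%R| (ltn0Sn l)).
  move: (ltn_pmod `|(v + (16 * l)%:Z)%R| (ltn0Sn l)).
  move: (_ %% _)%N (_ %% _)%N => r1 r2 ? ? e1 e2 e3; rewrite e3 in e1.
  move: (_ * _)%N e1 e2 => q e1 e2; lia.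
have cell_inj : injective cell.
  move=> i j cij; have [/far/(_ cij)|/far/(_ (esym cij))|/val_inj] := ltngtP i j.
  - by case.
  - by case.
  - by [].
have := leq_card cell cell_inj.
by rewrite card_ord card_ffun !card_ord ltnn.
Qed.

(* The bounded slack t makes the condition invariant under the action. *)
Definition recurrent i : set F := [set x | exists t, forall k0, exists k,
  (k0 <= k)%N /\ nbh (16 ^ k + t) (layer (16 ^ k) i) x].

Definition first_recurrent i : set F :=
  [set x | recurrent i x /\ forall j, (j < i)%N -> ~ recurrent j x].

(** The selected index is the same along an orbit, so each orbit sees a single layer and separation
    is inherited. *)
Definition centers k : set F :=
  [set x | exists i, (layer (16 ^ k) i `&` first_recurrent i) x].

Lemma recurrent_close i r x y : close r x y -> recurrent i x -> recurrent i y.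
Proof.
move=> xy [t xt]; exists (r + t)%N => k0; have [k [kk0 xk]] := xt k0.
exists k; split=> //; rewrite addnCA.
exact: nbh_close (close_sym xy) xk.
Qed.

Lemma first_recurrent_close i r x y :
  close r x y -> first_recurrent i x -> first_recurrent i y.
Proof.
move=> xy [ix jx]; split; first exact: (recurrent_close xy ix).
by move=> j /jx nj jy; apply: nj; exact: (recurrent_close (close_sym xy) jy).
Qed.

(** The number of layers does not grow with the scale: if each of them stopped covering [x] from
    some scale on, none would cover it at the maximum [k] of these bounds. *)
Lemma recurrent_exists x : exists i, recurrent i x.
Proof.
apply: contrapT => N.
have /choice[b bP] : forall i, exists k0, forall k, (k0 <= k)%N ->
    ~ nbh (16 ^ k) (layer (16 ^ k) i) x.
  move=> i; apply: contrapT => Ni; apply: N; exists i, 0%N => k0.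
  apply: contrapT => Nk; apply: Ni; exists k0 => k kk0 xk; apply: Nk.
  by exists k; rewrite addn0.
pose k := (\max_(i < (33 ^ n).+1) b i)%N.
have [i iK xi] := layer_cover (16 ^ k) x.
by apply: (bP i k) xi; exact: (leq_bigmax (Ordinal (iK : (i < (33 ^ n).+1)%N))).
Qed.

Lemma first_recurrent_exists x : exists i, first_recurrent i x.
Proof.
have ex : exists i, `[< recurrent i x >].
  by have [i ix] := recurrent_exists x; exists i; apply/asboolP.
case: (ex_minnP ex) => i /asboolP ix imin; exists i; split=> // j ji /asboolP jx.
by move: (imin j jx); rewrite leqNgt ji.
Qed.

Lemma centers_separated k : separated (16 * 16 ^ k) (centers k).
Proof.
move=> x y [i [xi fx]] [j [yj fy]] xy.
have ij : i = j.
  have [yi imin] := first_recurrent_close xy fx; have [jy jmin] := fy.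
  by case: (ltngtP i j) => // [/jmin|/imin].
by move: yj; rewrite -ij => yi; exact: (@layer_separated (16 ^ k) i).
Qed.

Lemma centers_cover x : exists k, nbh (2 * 16 ^ k) (centers k) x.
Proof.
have [i fx] := first_recurrent_exists x; have [[t xt] _] := fx.
(* Choosing [k] at least [t] absorbs the slack, as [t] is then below [16 ^ k]. *)
have [k [tk [y xy yi]]] := xt t; exists k, y.
  apply: close_le xy; rewrite mul2n -addnn leq_add2l (leq_trans tk) // ltnW //.
  exact: ltn_expl.
by exists i; split=> //; exact: (first_recurrent_close xy fx).
Qed.

Lemma borel_centers k : borel_set (centers k).
Proof.
have brec i : borel_set (recurrent i).
  apply: borel_exists => t; apply: borel_forall => k0; apply: borel_exists => k'.
  apply: (@borel_setI _ [set _ | _]); first exact: borel_const.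
  by apply: borel_nbh; exact: borel_layer.
apply: borel_exists => i; apply: borel_setI; first exact: borel_layer.
apply: borel_setI => //; apply: borel_forall => j.
rewrite [X in borel_set X](_ : _ = [set _ | ~ (j < i)%N] `|` ~` recurrent j).
  by apply: borel_setU; [exact: borel_const|exact: borel_setC].
apply/seteqP; split=> x /= => [H|[nji|nj] //].
by have [/H|] := pselect (j < i)%N; [right|left].
Qed.

End Centers.

(** * Sealed regions and the coloring *)

Section Paths.
Variable n : nat.
Local Notation F := (free_space n).
Implicit Types (x y z : F) (A B V W : set F).

(** Steps are taken in the supremum norm, so diagonal moves are allowed and components are coarser
    than those of the Schreier graph. *)
Fixpoint path W m x y : Prop :=
  if m is m'.+1 then W x /\ exists2 z, close 1 x z & path W m' z y
  else W x /\ x = y.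

Definition connected W x y := exists m, path W m x y.

Lemma connected_refl W x : W x -> connected W x x.
Proof. by exists 0%N. Qed.

Lemma connected_step W x y z :
  W x -> close 1 x y -> connected W y z -> connected W x z.
Proof. by move=> Wx xy [m p]; exists m.+1; split=> //; exists y. Qed.

Lemma connected_start W x y : connected W x y -> W x.
Proof. by case=> -[|m] []. Qed.

Lemma connected_ind W (P : F -> F -> Prop) :
  (forall x, W x -> P x x) ->
  (forall x z y, W x -> close 1 x z -> connected W z y -> P z y -> P x y) ->
  forall x y, connected W x y -> P x y.
Proof.
move=> P0 PS x y [m]; elim: m x => [x [Wx <-]|m IH x [Wx [z xz p]]]; first exact: P0.
by apply: (PS x z y) => //; [exists m|exact: IH].
Qed.

Lemma connected_trans W x y z :
  connected W x y -> connected W y z -> connected W x z.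
Proof.
move=> xy yz; move: x y xy yz; apply: connected_ind => // x u y Wx xu _ IH yz.
exact: (connected_step Wx xu (IH yz)).
Qed.

Lemma connected_sym W x y : connected W x y -> connected W y x.
Proof.
move: x y; apply: connected_ind => [x|x u y Wx xu uy yu]; first exact: connected_refl.
apply: connected_trans yu _.
exact: (connected_step (connected_start uy) (close_sym xu) (connected_refl Wx)).
Qed.

Lemma connected_sub V W x y : V `<=` W -> connected V x y -> connected W x y.
Proof.
move=> VW; move: x y; apply: connected_ind => [x /VW|x u y /VW Wx xu _ uy].
  exact: connected_refl.
exact: (connected_step Wx xu uy).
Qed.

Definition saturation W B : set F := [set x | exists2 y, connected W x y & B y].

Lemma borel_saturation W B :
  borel_set W -> borel_set B -> borel_set (saturation W B).
Proof.
move=> bW bB.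
pose S m := [set x | exists2 y, path W m x y & B y].
have bS m : borel_set (S m).
  elim: m => [|m IH].
    rewrite (_ : S _ = W `&` B); first exact: borel_setI.
    by apply/seteqP; split=> x; [case=> _ [Wx <-]|case=> Wx Bx; exists x].
  rewrite (_ : S _ = W `&` nbh 1 (S m)).
    by apply: borel_setI => //; exact: borel_nbh.
  apply/seteqP; split=> x.
    by case=> y [Wx [z xz p]] By; split=> //; exists z => //; exists y.
  by case=> Wx [z xz [y p By]]; exists y => //; split=> //; exists z.
rewrite (_ : saturation _ _ = [set x | exists m, S m x]); first exact: borel_exists.
apply/seteqP; split=> x; first by case=> y [m p] By; exists m, y.
by case=> m [y p By]; exists y => //; exists m.
Qed.

Definition rim V : set F := nbh 2 V `\` V.

Lemma borel_rim V : borel_set V -> borel_set (rim V).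
Proof.
move=> bV; rewrite /rim setDE; apply: borel_setI; first exact: borel_nbh.
exact: borel_setC.
Qed.

(* Adding the neighbors of every rim component met by B seals these components. *)
Definition extend B V : set F := V `|` B `|` nbh 1 (saturation (rim V) B).

(** However a rim point enters, its component meets [B]: it is in [B] itself, or it is adjacent to a
    rim point joined to [B]. Its neighbors are then added with it. *)
Lemma extend_seals B V x y :
  rim V x -> extend B V x -> close 1 x y -> extend B V y.
Proof.
move=> rx ex xy; right; exists x; first exact: close_sym.
case: ex => [[Vx|Bx]|[u xu [v uv Bv]]].
- by case: rx => _ /(_ Vx).
- by exists x => //; exact: connected_refl.
- by exists v => //; exact: (connected_step rx xu uv).
Qed.

End Paths.

Section Stages.
Variable n : nat.
Local Notation F := (free_space n).
Implicit Types (x y z m : F) (k : nat).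

Let radius k := (16 ^ k)%N.

Definition core k : set F := nbh (2 * radius k) (@centers n k).

Fixpoint stage k : set F := if k is j.+1 then extend (core j) (stage j) else set0.

Definition fresh k : set F := stage k.+1 `\` stage k.

Lemma stage_le i j : (i <= j)%N -> stage i `<=` stage j.
Proof.
elim: j => [|j IH]; first by rewrite leqn0 => /eqP->.
rewrite leq_eqVlt => /orP[/eqP->//|/IH ij].
by apply: subset_trans ij _; left; left.
Qed.

Lemma borel_stage k : borel_set (stage k).
Proof.
elim: k => [|k IH]; first exact: sigma_algebra0.
have bc : borel_set (core k) by apply: borel_nbh; exact: borel_centers.
apply: borel_setU; first exact: borel_setU.
by apply: borel_nbh; apply: borel_saturation => //; exact: borel_rim.
Qed.

Lemma borel_fresh k : borel_set (fresh k).
Proof.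
rewrite /fresh setDE; apply: borel_setI; first exact: borel_stage.
by apply: borel_setC; exact: borel_stage.
Qed.

Lemma fresh_exists x : exists k, fresh k x.
Proof.
have ex : exists k, `[< stage k x >].
  have [k xk] := centers_cover x; exists k.+1; apply/asboolP.
  by left; right.
case: (ex_minnP ex) => -[|k] /asboolP // xk kmin; exists k; split=> // /asboolP.
by move/kmin; rewrite ltnn.
Qed.

(** The bound adds 1 to reach a component, [radius k] to cross it and [2 * radius k] to reach a
    center. The diameter bound is a hypothesis so that the lemma can serve inside the induction
    proving it. *)
Lemma stage_center_of k x :
  (forall y z, connected (nbh 2 (stage k)) y z -> close (radius k) y z) ->
  stage k.+1 x -> ~ stage k x -> nbh (3 * radius k + 1) (@centers n k) x.
Proof.
move=> diam [[//|xc]|[u xu [v uv [m vm cm]]]] _.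
  by apply: nbh_le xc; lia.
exists m => //.
have {}uv : close (radius k) u v.
  by apply: diam; apply: connected_sub uv => w [].
apply: close_le (close_trans xu (close_trans uv vm)); lia.
Qed.

(* Two centers joined through components of the previous stage would be too
   close, so a component of a stage contains at most one new region. *)
Lemma stage_diameter k x y :
  connected (nbh 2 (stage k)) x y -> close (radius k) x y.
Proof.
elim: k x y => [|k IH] x y; first by move/connected_start => [z _ []].
set T := nbh 2 (stage k); set l := radius k.
have l0 : (0 < l)%N by rewrite /l /radius expn_gt0.
have radiusS : radius k.+1 = (16 * l)%N by rewrite /radius expnS.
have TS w : nbh 2 (stage k.+1) w -> T w \/ nbh (3 * l + 3) (@centers n k) w.
  move=> [v wv sv].
  have [kv|nkv] := pselect (stage k v); [by left; exists v|right].
  have := nbh_close wv (stage_center_of IH sv nkv).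
  by apply: nbh_le; lia.
(* Near a center directly, or after crossing one component of [T]; the 1 extra in [3 * l + 4] pays
   for the step leaving it. *)
pose near w m := close (3 * l + 3) w m \/
  exists2 v, connected T w v & close (3 * l + 4) v m.
have near_close w m : near w m -> close (4 * l + 4) w m.
  case=> [|[v /IH wv vm]]; first by apply: close_le; lia.
  by apply: close_le (close_trans wv vm); rewrite -/l; lia.
have near_step w w' m : T w -> close 1 w w' -> near w' m -> near w m.
  move=> Tw ww' [w'm|[v w'v vm]]; right.
    exists w; first exact: connected_refl.
    by apply: close_le (close_trans ww' w'm); lia.
  by exists v => //; exact: (connected_step Tw ww' w'v).
(* A path either stays in [T] or has both ends near one center, and [2 * (4 * l + 4) <= 16 * l]
   since [l] is positive. *)
suff : forall x y, connected (nbh 2 (stage k.+1)) x y ->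
    connected T x y \/ exists2 m, centers k m & near x m /\ near y m.
  move=> /[apply]; rewrite radiusS => -[/IH|[m _ [/near_close xm /near_close ym]]].
    by apply: close_le; rewrite -/l; lia.
  by apply: close_le (close_trans xm (close_sym ym)); lia.
apply: connected_ind => {x y} [x /TS[Tx|[m xm cm]]|x x' y /TS + xx' _].
- by left; exact: connected_refl.
- by right; exists m => //; split; left.
case=> [Tx|[m xm cm]] [x'y|[m' cm' [x'm' ym']]].
- by left; exact: (connected_step Tx xx' x'y).
- by right; exists m' => //; split=> //; exact: (near_step _ _ _ Tx xx').
- right; exists m => //; split; first by left.
  right; exists x'; first exact: connected_sym.
  by apply: close_le (close_trans (close_sym xx') xm); lia.
- right; exists m' => //; split=> //.
  (* The distance is at most [(3 * l + 3) + 1 + (4 * l + 4)], within the separation [16 * l]. *)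
  have mm' : m = m'.
    apply: (@centers_separated _ k) => //.
    have := close_trans (close_sym xm) (close_trans xx' (near_close _ _ x'm')).
    by apply: close_le; rewrite -/(radius k) -/l; lia.
  by left; rewrite -mm'.
Qed.

Lemma fresh_center k x : fresh k x -> nbh (3 * radius k + 1) (@centers n k) x.
Proof. by case=> sx nx; apply: stage_center_of => // y z /stage_diameter. Qed.

(** Stages increase, so testing a point against the last stage before its entry detects every
    earlier rim. *)
Definition in_rim : set F := [set x | exists k, (fresh k `&` rim (stage k)) x].

Definition odd_point : set F := [set x | exists k, fresh k x /\ exists g,
  (parity g /\ (nrm g <= 3 * radius k + 1)%N) /\ centers k (act g x)].

Lemma borel_in_rim : borel_set in_rim.
Proof.
apply: borel_exists => k; apply: borel_setI; first exact: borel_fresh.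
by apply: borel_rim; exact: borel_stage.
Qed.

Lemma borel_odd_point : borel_set odd_point.
Proof.
apply: borel_exists => k; apply: (@borel_setI _ (fresh k) [set _ | _]).
  exact: borel_fresh.
apply: borel_exists => g.
apply: (@borel_setI _ [set _ | parity g /\ _] (act g @^-1` centers k)).
  exact: borel_const.
by apply: borel_act; exact: borel_centers.
Qed.

Lemma fresh_uniq i j x : fresh i x -> fresh j x -> i = j.
Proof.
move=> [si ni] [sj nj]; case: (ltngtP i j) => // ij; exfalso.
  by apply: nj; exact: (stage_le ij).
by apply: ni; exact: (stage_le ij).
Qed.

(** Two centers within [3 * radius k + 1] of [x] are closer than the separation, hence equal; any
    such center therefore decides the parity. *)
Lemma odd_pointP k x g : fresh k x -> (nrm g <= 3 * radius k + 1)%N ->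
  centers k (act g x) -> `[< odd_point x >] = parity g.
Proof.
move=> fx gk cg; apply/asboolP/idP => [[j [fj [h [[ph hj] ch]]]]|pg]; last first.
  by exists k; split=> //; exists g.
have jk := fresh_uniq fj fx; rewrite {j fj}jk in hj ch.
suff -> : g = h by [].
apply: (@act_inj _ _ _ x); apply: (@centers_separated _ k) => //.
have xg : close (3 * radius k + 1) x (act g x) by exists g.
have xh : close (3 * radius k + 1) x (act h x) by exists h.
apply: close_le (close_trans (close_sym xg) xh).
have : (0 < radius k)%N by rewrite /radius expn_gt0.
by rewrite -/(radius k); lia.
Qed.

Lemma odd_point_act k g x : (nrm g <= 2)%N -> fresh k x -> fresh k (act g x) ->
  `[< odd_point (act g x) >] = parity g (+) `[< odd_point x >].
Proof.
move=> g2 fx fgx.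
have [m [h hk hm] cm] := fresh_center fx.
have [m' [h' h'k h'm] cm'] := fresh_center fgx.
have e : h = h' + g.
  apply: (@act_inj _ _ _ x); rewrite -actD -hm -h'm.
  apply: (@centers_separated _ k) => //.
  have xm : close (3 * radius k + 1) x m by exists h.
  have gxm' : close (3 * radius k + 1) (act g x) m' by exists h'.
  have xgx : close 2 x (act g x) by exists g.
  apply: close_le (close_trans (close_sym xm) (close_trans xgx gxm')).
  have : (0 < radius k)%N by rewrite /radius expn_gt0.
  by rewrite -/(radius k); lia.
rewrite h'm in cm'; rewrite hm in cm.
by rewrite (odd_pointP fx hk cm) (odd_pointP fgx h'k cm') e parityD addbA addbAC addbb.
Qed.

(** If one point entered strictly earlier, the other would lie within 2 of the stage preceding its
    own entry, that is, in the rim. *)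
Lemma fresh_outside_rim x y :
  ~ in_rim x -> ~ in_rim y -> close 2 x y -> exists2 k, fresh k x & fresh k y.
Proof.
have sub i j u v : close 2 u v -> fresh i u -> fresh j v -> ~ in_rim v -> ~ (i < j)%N.
  move=> uv [su _] fv nv ij; apply: nv; exists j; split=> //.
  split; last by case: fv.
  by exists u; [exact: close_sym|exact: (stage_le ij)].
move=> nx ny xy; have [i fx] := fresh_exists x; have [j fy] := fresh_exists y.
exists i => //; suff -> : i = j by [].
case: (ltngtP i j) => // ij; exfalso.
  exact: (sub i j x y).
exact: (sub j i y x (close_sym xy)).
Qed.

(** By [extend_seals], the rim point that enters first brings its neighbors into the same stage. *)
Lemma fresh_in_rim x y :
  in_rim x -> in_rim y -> close 1 x y -> exists2 k, fresh k x & fresh k y.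
Proof.
have sub i j u v : close 1 u v -> fresh i u -> rim (stage i) u -> fresh j v -> ~ (i < j)%N.
  move=> uv [su _] ru [_ nv] ij; apply: nv; apply: (stage_le ij).
  exact: (extend_seals ru su uv).
move=> [i [fx rx]] [j [fy ry]] xy.
exists i => //; suff -> : i = j by [].
case: (ltngtP i j) => // ij; exfalso.
  exact: (sub i j x y).
exact: (sub j i y x (close_sym xy)).
Qed.

(** * The three-coloring and its properness *)

Definition even_outside : set F := ~` in_rim `&` ~` odd_point.

Definition has_even_outside_neighbor : set F :=
  [set x | exists g, ([set _ | standard_generators g] `&` act g @^-1` even_outside) x].

Definition color x : nat :=
  if `[< in_rim x >] then
    if `[< odd_point x >] then
      if `[< has_even_outside_neighbor x >] then 1 else 0
    else 2
  else if `[< odd_point x >] then 1 else 0.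

Lemma color_lt3 x : (color x < 3)%N.
Proof. by rewrite /color; do !case: asboolP. Qed.

Lemma borel_if (A : set F) (f g : F -> nat) :
  borel_set A ->
  (forall c, borel_set [set x | f x = c]) ->
  (forall c, borel_set [set x | g x = c]) ->
  forall c, borel_set [set x | (if `[< A x >] then f x else g x) = c].
Proof.
move=> bA bf bg c; rewrite (_ : [set x | _] =
    (A `&` [set x | f x = c]) `|` (~` A `&` [set x | g x = c])).
  by apply: borel_setU; apply: borel_setI => //; exact: borel_setC.
apply/seteqP; split=> x /=; case: asboolP => Ax; rewrite /setU /setI /setC /=; tauto.
Qed.

Lemma borel_color : borel_map color.
Proof.
have bo := borel_odd_point; have br := borel_in_rim.
apply: borel_mapP; apply: borel_if => //; last first.
  by apply: borel_if => // c; exact: borel_const.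
apply: borel_if => //; last by move=> c; exact: borel_const.
apply: borel_if => [|c|c]; try exact: borel_const.
apply: borel_exists => g; apply: borel_setI; first exact: borel_const.
by apply: borel_act; apply: borel_setI; exact: borel_setC.
Qed.

Lemma color_proper s x : standard_generators s -> color (act s x) <> color x.
Proof.
have mixed t y : standard_generators t -> in_rim y -> ~ in_rim (act t y) ->
    color (act t y) <> color y.
  move=> gt ry nr; rewrite /color.
  case: (asboolP (in_rim y)) => // _; case: (asboolP (in_rim (act t y))) => // _.
  case: (asboolP (odd_point y)) => oy; last by case: ifP.
  (* An even outside neighbor, colored 0, is itself the witness that gives [y] the color 1. *)
  case: (asboolP (odd_point (act t y))) => ot; last first.
    by rewrite asboolT //; exists t.
  (* An even outside neighbor [act u y] would be within 2 of the odd one [act t y], hence in the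
     same region, while [t - u] has even parity. *)
  rewrite asboolF // => -[u [gu [nu eu]]].
  have tu : act t y = act (t - u) (act u y) by rewrite actD subrK.
  have ntu : (nrm (t - u) <= 2)%N.
    apply: leq_trans (nrmD _ _) _; rewrite nrmN.
    by have := nrm_generator gt; have := nrm_generator gu; lia.
  have [|k fu ft] := fresh_outside_rim nu nr; first by exists (t - u).
  rewrite tu in ft ot; move/asboolP: ot.
  by rewrite (odd_point_act ntu fu ft) parityD parityN !parity_generator //= => /asboolP.
move=> gs; have s1 := nrm_generator gs; have ps := parity_generator gs.
have xsx : close 1 x (act s x) by exists s.
have [rx|nx] := pselect (in_rim x); have [ry|ny] := pselect (in_rim (act s x)).
- have [k fx fy] := fresh_in_rim rx ry xsx.
  (* The two parities differ, so exactly one of the two points has color 2. *)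
  rewrite /color (odd_point_act (leqW s1) fx fy) ps (asboolT rx) (asboolT ry).
  by case: `[< odd_point x >] => /=; case: ifP.
- exact: (mixed s x gs rx ny).
- move/esym; rewrite -{1}(actNK s x); apply: mixed => //; last by rewrite actNK.
  exact: generatorN.
- have [|k fx fy] := fresh_outside_rim nx ny; first exact: close_le xsx.
  rewrite /color (odd_point_act (leqW s1) fx fy) ps (asboolF nx) (asboolF ny).
  by case: `[< odd_point x >].
Qed.

End Stages.

Theorem corollary4p10 (n : nat) (hn : (1 <= n)%N) :
  is_borel_chromatic_number (schreier_graph n) (Some 3%N).
Proof.
split.
  exists (@color n); split; [exact: borel_color|exact: color_lt3|].
  move=> x y [s gs yx]; have -> : y = act s x by exact: free_space_inj.
  by move/esym; exact: color_proper.
move=> lambda [c [bc cl ce]].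
pose i0 := Ordinal hn.
have c_act x : c (act (delta_mx 0 i0) x) <> c x.
  by move/esym; apply: ce; exists (delta_mx 0 i0) => //; exists i0; left.
case: lambda cl => [k ck|_] /=; last by apply: subset_card_le.
rewrite card_le_II leqNgt; apply/negP => k3.
have c01 x : c x = 0%N \/ c x = 1%N.
  by have := leq_trans (ck x) (k3 : (k <= 2)%N); case: (c x) => [|[]]; auto.
(* With only the colors 0 and 1, the generator exchanges the class of 0 with its complement. *)
apply: (@alternating_not_borel n i0 [set x | c x = 0%N]); last first.
  exact: (bc [set 0%N] (borel_open (discrete_open _))).
move=> x /=; have := c_act x.
by case: (c01 x) => ->; case: (c01 (act (delta_mx 0 i0) x)) => -> ne; split=> ?; congruence.
Qed.
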